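(* If a signed graph $SG$ has a negative loop $e$, then $H^i_b(SG)\cong H^i_b(SG-e)$ for all $i$.
   Context: Signed graphs: $SG=(G,\sigma)$, $G$ finite (loops, multiple edges allowed), $\sigma:E(G)\to\{\pm1\}$; a negative loop is a loop with sign $-1$; $SG-e$ deletes $e$. Negative circuit: product of edge signs $-1$ (a loop is a circuit of one edge); balanced = no negative circuit. $[G:s]$, $[SG:s]$: spanning subgraph with edge set $s$. Balanced complex: Fix a total order on $E(G)$. An enhanced state of $G$ is $S=(s,c)$, $c$ labels each component of $[G:s]$ by $1$ or $x$; $j(S)$ = number of $x$-labels (grading). With $m(1,1)=1$, $m(1,x)=m(x,1)=x$, $m(x,x)=0$: for $e'\notin s$, $S_{e'}=(s\cup\{e'\},c_{e'})$ where a component containing both ends of $e'$ keeps its label and if $e'$ joins components $E_i,E_j$ the merged one gets $m(c(E_i),c(E_j))$ ($S_{e'}=0$ if both are $x$). $d(S)=\sum_{e'\notin s}(-1)^{n(e')}S_{e'}$, $n(e')$ = number of edges of $s$ preceding $e'$. $H^i_b(SG)$: cohomology of $C^\bullet_b(SG)$, free on enhanced states with $[SG:s]$ balanced, differential $d_b=f_b\circ d$, where $f_b$ sends an enhanced state to itself if $[SG:s]$ is balanced and to $0$ otherwise. *)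

(* Defs.v *)
From mathcomp Require Import all_boot all_order all_algebra.
Set Implicit Arguments. Unset Strict Implicit. Unset Printing Implicit Defensive.
Import GRing.Theory.
Local Open Scope ring_scope.

(* A signed graph: vertices 'I_nv, edges 'I_ne (the total order on edges is
   the natural order of 'I_ne), each edge has two (possibly equal) endpoints,
   neg e = true means sigma(e) = -1. Loops and multiple edges allowed. *)
Record SGraph := SG {
  nv : nat;
  ne : nat;
  ends : 'I_ne -> 'I_nv * 'I_nv;
  neg : 'I_ne -> bool }.
Arguments ends s _ : clear implicits.
Arguments neg s _ : clear implicits.

Definition is_neg_loop (G : SGraph) (e : 'I_(ne G)) : bool :=
  ((ends G e).1 == (ends G e).2) && neg G e.

(* SG - e : delete edge e; remaining edges keep their relative order. *)
Definition del_edge (G : SGraph) (e : 'I_(ne G)) : SGraph :=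
  @SG (nv G) (ne G).-1 (fun j => ends G (lift e j)) (fun j => neg G (lift e j)).

Definition joins (G : SGraph) (e : 'I_(ne G)) (u v : 'I_(nv G)) : bool :=
  (ends G e == (u, v)) || (ends G e == (v, u)).

Definition adj (G : SGraph) (s : {set 'I_(ne G)}) : rel 'I_(nv G) :=
  fun u v => [exists e in s, joins e u v].

(* A circuit in [G:s]: distinct edges es = e_1..e_k (k >= 1) and distinct
   vertices vs = v_0..v_{k-1}, with e_j joining v_{j-1} and v_j (indices mod k).
   k = 1 is a loop. *)
Definition circuit (G : SGraph) (s : {set 'I_(ne G)})
  (es : seq 'I_(ne G)) (vs : seq 'I_(nv G)) : bool :=
  [&& (0 < size es)%N, size vs == size es, uniq es, uniq vs,
      all (fun e => e \in s) es &
      all (fun t => joins t.1 t.2.1 t.2.2) (zip es (zip vs (rot 1 vs)))].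

(* [SG:s] is balanced: no negative circuit (sign product -1, i.e. an odd
   number of negative edges). *)
Definition balanced (G : SGraph) (s : {set 'I_(ne G)}) : Prop :=
  ~ exists es vs, circuit s es vs && odd (count (neg G) es).

(* Enhanced-state candidates: (s, c) with c a labelling of the vertices,
   true = x, false = 1. *)
Definition St (G : SGraph) : finType :=
  ({set 'I_(ne G)} * {ffun 'I_(nv G) -> bool})%type.

(* c is constant on the components of [G:s], i.e. c is a labelling of the
   components of [G:s]. *)
Definition valid (G : SGraph) (S : St G) : bool :=
  [forall u, forall v, connect (adj S.1) u v ==> (S.2 u == S.2 v)].

(* S_{e'} (None stands for 0). *)
Definition Sedge (G : SGraph) (S : St G) (e : 'I_(ne G)) : option (St G) :=
  let s := S.1 in let c := S.2 in
  let u := (ends G e).1 in let w := (ends G e).2 in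
  if connect (adj s) u w then Some (e |: s, c)
  else if c u && c w then None
  else Some (e |: s, [ffun v => if connect (adj s) u v || connect (adj s) w v
                               then c u || c w else c v]).

Definition nprec (G : SGraph) (s : {set 'I_(ne G)}) (e : 'I_(ne G)) : nat :=
  #|[set e0 in s | (e0 < e)%N]|.

(* coefficient of T in d(S) *)
Definition dcoef (G : SGraph) (S T : St G) : int :=
  \sum_(e : 'I_(ne G) | e \notin S.1)
     (-1) ^+ (nprec S.1 e) * ((Sedge S e == Some T) : int).

(* Z-valued cochains: formal Z-combinations of enhanced states *)
Definition cochain (G : SGraph) := {ffun St G -> int}.

Definition dd (G : SGraph) (x : cochain G) : cochain G :=
  [ffun T => \sum_(S : St G) x S * dcoef S T].

(* x lies in C^i_b(SG): supported on enhanced states with [SG:s] balanced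
   and |s| = i *)
Definition inCb (G : SGraph) (i : nat) (x : cochain G) : Prop :=
  forall S, x S != 0 -> [/\ valid S, balanced S.1 & #|S.1| = i].

(* y = d_b x  (d_b = f_b o d: keep the balanced states) *)
Definition is_db (G : SGraph) (x y : cochain G) : Prop :=
  forall T, (balanced T.1 -> y T = dd x T) /\ (~ balanced T.1 -> y T = 0).

Definition cocycle (G : SGraph) (i : nat) (z : cochain G) : Prop :=
  inCb i z /\ is_db z 0.

(* coboundaries of degree i (C^{-1} = 0) *)
Definition coboundary (G : SGraph) (i : nat) (y : cochain G) : Prop :=
  inCb i y /\
  match i with
  | 0 => y = 0
  | i'.+1 => exists x, inCb i' x /\ is_db x y
  end.

(* f : C^i_b(G1) -> C^i_b(G2) induces a group homomorphism
   H^i_b(G1) -> H^i_b(G2) (well-defined on classes, additive on classes). *)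
Definition induces_hom (G1 G2 : SGraph) (i : nat) (f : cochain G1 -> cochain G2) : Prop :=
  [/\ forall z, cocycle i z -> cocycle i (f z),
      forall z z', cocycle i z -> cocycle i z' -> coboundary i (z - z') ->
                   coboundary i (f z - f z') &
      forall z z', cocycle i z -> cocycle i z' ->
                   coboundary i (f (z + z') - f z - f z')].

(* H^i_b(G1) ~= H^i_b(G2) as abelian groups: there are maps on
   representatives inducing mutually inverse homomorphisms on cohomology. *)
Definition Hb_iso (G1 G2 : SGraph) (i : nat) : Prop :=
  exists (f : cochain G1 -> cochain G2) (g : cochain G2 -> cochain G1),
    [/\ induces_hom i f, induces_hom i g,
        forall z, cocycle i z -> coboundary i (g (f z) - z) &
        forall z, cocycle i z -> coboundary i (f (g z) - z)].

(* Main.v *)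
Require Import Defs.
From mathcomp Require Import all_boot all_order all_algebra.
Set Implicit Arguments. Unset Strict Implicit. Unset Printing Implicit Defensive.
Import GRing.Theory.
Local Open Scope ring_scope.

(* Write SG - e for the graph obtained by deleting the negative loop e.  Its
   edges are those of SG other than e, in the same order, via the injection
   [lift e]; so an enhanced state T of SG - e gives the enhanced state
   [del_state e T] of SG with the same labelling and edge set [lift e @: T.1].
   This identification preserves components, circuits, signs, the numbers
   n(e') and the coefficients of d, and its image is exactly the set of
   states not containing e.  Since a negative loop is a negative circuit on
   its own, every balanced state of SG avoids e: the balanced complexes of SG
   and SG - e are isomorphic, the isomorphism being the pullback along
   [del_state e] with inverse the pushforward (extension by zero). *)

Definition cochain_map (G1 G2 : SGraph) (F : cochain G1 -> cochain G2) : Prop :=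
  [/\ forall x y, F (x - y) = F x - F y,
      forall k x, inCb k x -> inCb k (F x) &
      forall k x y, inCb k x -> is_db x y -> is_db (F x) (F y)].

Lemma inCb0 (G : SGraph) (k : nat) : inCb (G:=G) k 0.
Proof. by move=> S; rewrite ffunE eqxx. Qed.

Lemma is_db00 (G : SGraph) : is_db (G:=G) 0 0.
Proof.
move=> T; split=> _; rewrite ffunE //.
by rewrite /dd ffunE big1 // => S _; rewrite ffunE mul0r.
Qed.

Lemma coboundary0 (G : SGraph) (i : nat) : coboundary (G:=G) i 0.
Proof.
split; first exact: inCb0.
by case: i => [|k] //; exists 0; split; [exact: inCb0 | exact: is_db00].
Qed.

Lemma cochain_map_induces_hom (G1 G2 : SGraph) (F : cochain G1 -> cochain G2)
    (i : nat) :
  cochain_map F -> induces_hom i F.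
Proof.
case=> FB Fin Fdb.
have F0 : F 0 = 0 by rewrite -(subrr 0) FB subrr.
have FN y : F (- y) = - F y by rewrite -sub0r FB F0 sub0r.
have FD x y : F (x + y) = F x + F y by rewrite -{1}[y]opprK FB FN opprK.
have Fcob y : coboundary i y -> coboundary i (F y).
  case=> yi Hy; split; first exact: Fin.
  case: i yi Hy => [|k] yi; first by move=> ->.
  by case=> x [xk db]; exists (F x); split; [exact: Fin | exact: Fdb xk db].
split.
- by move=> z [zi db]; split; [exact: Fin | rewrite -F0; exact: Fdb zi db].
- by move=> z z' _ _ /Fcob; rewrite FB.
- by move=> z z' _ _; rewrite FD (addrC (F z)) addrK subrr; apply: coboundary0.
Qed.

Lemma Hb_iso_of_inverse_cochain_maps (G1 G2 : SGraph)
    (F : cochain G1 -> cochain G2) (F' : cochain G2 -> cochain G1) (i : nat) :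
  cochain_map F -> cochain_map F' ->
  (forall k z, inCb k z -> F' (F z) = z) ->
  (forall k z, inCb k z -> F (F' z) = z) ->
  Hb_iso G1 G2 i.
Proof.
move=> mapF mapF' FF' F'F; exists F, F'; split.
- exact: cochain_map_induces_hom.
- exact: cochain_map_induces_hom.
- by move=> z [zi _]; rewrite (FF' _ _ zi) subrr; apply: coboundary0.
- by move=> z [zi _]; rewrite (F'F _ _ zi) subrr; apply: coboundary0.
Qed.

Section PullbackPushforward.
Variables (R : pzRingType) (A B : finType) (f : A -> B).
Hypothesis f_inj : injective f.

Definition pullback (x : {ffun B -> R}) : {ffun A -> R} := [ffun a => x (f a)].

Definition pushforward (y : {ffun A -> R}) : {ffun B -> R} :=
  [ffun b => \sum_(a | f a == b) y a].

Lemma pushforwardE (y : {ffun A -> R}) (a : A) : pushforward y (f a) = y a.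
Proof.
rewrite ffunE; under eq_bigl => a' do rewrite (inj_eq f_inj).
by rewrite big_pred1_eq.
Qed.

Lemma pushforward_out (y : {ffun A -> R}) (b : B) :
  (forall a, f a != b) -> pushforward y b = 0.
Proof. by move=> fb; rewrite ffunE big_pred0 // => a; apply/negbTE. Qed.

Lemma sum_pushforward (y : {ffun A -> R}) (h : B -> R) :
  \sum_b pushforward y b * h b = \sum_a y a * h (f a).
Proof.
under eq_bigr => b _ do rewrite ffunE big_distrl /=.
rewrite (exchange_big_dep predT) //=; apply: eq_bigr => a _.
by under eq_bigl => b do rewrite eq_sym; rewrite big_pred1_eq.
Qed.

Lemma pushforwardK : cancel pushforward pullback.
Proof. by move=> y; apply/ffunP => a; rewrite ffunE pushforwardE. Qed.

Lemma pullbackK (x : {ffun B -> R}) :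
  (forall b, x b != 0 -> exists a, f a = b) -> pushforward (pullback x) = x.
Proof.
move=> supp; apply/ffunP => b.
case: (boolP [exists a, f a == b]) => [/existsP [a /eqP <-]|].
  by rewrite pushforwardE ffunE.
rewrite negb_exists => /forallP nfb; rewrite pushforward_out //.
case: (eqVneq (x b) 0) => [-> //|/supp [a fab]].
by move: (nfb a); rewrite fab eqxx.
Qed.

Lemma pullbackB (x x' : {ffun B -> R}) :
  pullback (x - x') = pullback x - pullback x'.
Proof. by apply/ffunP => a; rewrite !ffunE. Qed.

Lemma pushforwardB (y y' : {ffun A -> R}) :
  pushforward (y - y') = pushforward y - pushforward y'.
Proof.
apply/ffunP => b; rewrite !ffunE -sumrB.
by apply: eq_bigr => a _; rewrite !ffunE.
Qed.

End PullbackPushforward.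

Lemma lift_ltn (n : nat) (h : 'I_n) (i j : 'I_n.-1) :
  (lift h i < lift h j)%N = (i < j)%N.
Proof. by rewrite /= !ltnNge leq_bump2. Qed.

Lemma notin_lift (n : nat) (h : 'I_n) (A : {pred 'I_n.-1}) : h \notin lift h @: A.
Proof. by apply/imsetP => -[j _ /eqP]; rewrite eq_liftF. Qed.

Lemma map_lift_pmap (n : nat) (h : 'I_n) (s : seq 'I_n) :
  h \notin s -> map (lift h) (pmap (unlift h) s) = s.
Proof.
move=> hs; rewrite pmap_filter; last by move=> x; case: unliftP.
apply/all_filterP/allP => x xs; case: unliftP => // xh.
by move: hs; rewrite -xh xs.
Qed.

Lemma all_zip_mapl (A B C : Type) (f : A -> B) (P : pred (B * C))
    (s : seq A) (t : seq C) :
  all P (zip (map f s) t) = all (fun p => P (f p.1, p.2)) (zip s t).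
Proof. by elim: s t => [|a s IH] [|c t] //=; rewrite IH. Qed.

Lemma Sedge_mem (H : SGraph) (S T : St H) (e0 : 'I_(ne H)) :
  Sedge S e0 = Some T -> e0 \in T.1.
Proof.
rewrite /Sedge; case: ifP => _; first by case=> <- /=; rewrite setU11.
by case: ifP => // _ [<-] /=; rewrite setU11.
Qed.

Section DeleteEdge.
Variables (G : SGraph) (e : 'I_(ne G)).
Local Notation G' := (del_edge e).

Definition del_state (T : St G') : St G := (lift e @: T.1, T.2).

Lemma del_state_inj : injective del_state.
Proof. by move=> [s c] [s' c'] [/(imset_inj (@lift_inj _ e)) -> ->]. Qed.

Lemma del_state_onto (S : St G) : e \notin S.1 -> exists T, del_state T = S.
Proof.
case: S => s c /= es; exists ([set j | lift e j \in s], c); rewrite /del_state /=.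
congr (_, _); apply/setP => x; case: (unliftP e x) => [j ->|->].
  by rewrite mem_imset ?inE //; apply: lift_inj.
by rewrite (negbTE (notin_lift _ _)) (negbTE es).
Qed.

Lemma adj_del (s : {set 'I_(ne G')}) : adj (lift e @: s) =2 adj (G:=G') s.
Proof.
move=> u v; apply/existsP/existsP => [[x /andP [/imsetP [j js ->] J]]|].
  by exists j; rewrite js.
case=> j /andP [js J].
by exists (lift e j); rewrite imset_f.
Qed.

Lemma connect_del (s : {set 'I_(ne G')}) :
  connect (adj (lift e @: s)) =2 connect (adj (G:=G') s).
Proof. exact/eq_connect/adj_del. Qed.

Lemma valid_del (T : St G') : valid (del_state T) = valid T.
Proof.
apply/forallP/forallP => H u; apply/forallP => v; have /forallP/(_ v) := H u;
  by rewrite /del_state /= connect_del.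
Qed.

Lemma circuit_del (s : {set 'I_(ne G')}) (es : seq 'I_(ne G')) (vs : seq 'I_(nv G)) :
  circuit (lift e @: s) (map (lift e) es) vs = circuit (G:=G') s es vs.
Proof.
rewrite /circuit size_map (map_inj_uniq (@lift_inj _ e)) all_map all_zip_mapl.
congr [&& _, _, _, _, _ & _].
by apply: eq_all => x /=; rewrite mem_imset //; apply: lift_inj.
Qed.

(* Every circuit of [SG : lift e @: s] avoids e, hence comes from a circuit of
   [SG - e : s] with the same signs. *)
Lemma balanced_del (s : {set 'I_(ne G')}) :
  balanced (lift e @: s) <-> balanced (G:=G') s.
Proof.
split=> bal [es [vs /andP [C O]]]; apply: bal.
  by exists (map (lift e) es), vs; rewrite circuit_del C count_map.
have e_es : e \notin es.
  apply/negP => e_es; case/and5P: C => _ _ _ _ /andP [/allP /(_ e e_es) + _].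
  by rewrite (negbTE (notin_lift _ _)).
exists (pmap (unlift e) es), vs.
by rewrite -circuit_del -count_map map_lift_pmap // C.
Qed.

Lemma generator_del (k : nat) (T : St G') :
  [/\ valid (del_state T), balanced (del_state T).1 & #|(del_state T).1| = k] <->
  [/\ valid T, balanced T.1 & #|T.1| = k].
Proof.
rewrite valid_del /del_state /= card_imset; last exact: lift_inj.
by split=> -[-> /balanced_del]; split.
Qed.

(* The numbers n(e') agree, since [lift e] preserves the order of edges. *)
Lemma nprec_del (s : {set 'I_(ne G')}) (j : 'I_(ne G')) :
  nprec (lift e @: s) (lift e j) = nprec (G:=G') s j.
Proof.
rewrite /nprec -(card_imset _ (@lift_inj _ e)); apply: eq_card => x.
rewrite !inE; case: (unliftP e x) => [k ->|->].
  by rewrite !mem_imset ?inE ?lift_ltn //; apply: lift_inj.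
by rewrite (negbTE (notin_lift _ _)) (negbTE (notin_lift _ _)).
Qed.

Lemma Sedge_del (S : St G') (j : 'I_(ne G')) :
  Sedge (del_state S) (lift e j) = omap del_state (Sedge S j).
Proof.
case: S => s c; rewrite /Sedge /del_state /= !connect_del.
case: ifP => _ /=; first by rewrite imsetU1.
case: ifP => _ //=; rewrite imsetU1; congr (Some (_, _)).
by apply/ffunP => v; rewrite !ffunE !connect_del.
Qed.

(* The coefficients of d agree: adding e itself never yields a state from
   SG - e, and the other edges correspond with the same signs. *)
Lemma dcoef_del (S T : St G') :
  dcoef (del_state S) (del_state T) = dcoef (G:=G') S T.
Proof.
rewrite /dcoef (bigD1_ord e) ?notin_lift //=.
have -> : (Sedge (del_state S) e == Some (del_state T)) = false.
  by apply/eqP => /Sedge_mem; rewrite /= (negbTE (notin_lift _ _)).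
rewrite mulr0 add0r; apply: eq_big => j.
  by rewrite mem_imset //; apply: lift_inj.
move=> _; rewrite nprec_del Sedge_del; congr (_ * _).
case: (Sedge S j) => [x|] //=.
by rewrite !(inj_eq (@Some_inj _)) (inj_eq del_state_inj).
Qed.

Lemma dd_pushforward (y : cochain G') (T : St G') :
  dd (pushforward del_state y) (del_state T) = dd y T.
Proof.
by rewrite /dd !ffunE sum_pushforward; apply: eq_bigr => S _; rewrite dcoef_del.
Qed.

End DeleteEdge.
Arguments del_state {G} e T.

(* A negative loop is a negative circuit of length one. *)
Lemma neg_loop_unbalanced (G : SGraph) (e : 'I_(ne G)) (s : {set 'I_(ne G)}) :
  is_neg_loop e -> e \in s -> ~ balanced s.
Proof.
move=> /andP [loop_e neg_e] es; apply; exists [:: e], [:: (ends G e).1].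
rewrite /circuit /= es neg_e /= /joins andbT.
by case: (ends G e) loop_e => a b /= /eqP ->; rewrite eqxx.
Qed.

Section NegativeLoop.
Variables (G : SGraph) (e : 'I_(ne G)).
Hypothesis neg_loop_e : is_neg_loop e.
Local Notation G' := (del_edge e).

Definition restrict : cochain G -> cochain G' := pullback (del_state e).
Definition extend : cochain G' -> cochain G := pushforward (del_state e).

Lemma inCb_supported (k : nat) (x : cochain G) (S : St G) :
  inCb k x -> x S != 0 -> exists T, del_state e T = S.
Proof.
move=> xk /xk [_ bal _]; apply: del_state_onto; apply/negP => eS.
exact: neg_loop_unbalanced neg_loop_e eS bal.
Qed.

Lemma extend_restrict (k : nat) (x : cochain G) : inCb k x -> extend (restrict x) = x.
Proof.
by move=> xk; apply: (pullbackK (@del_state_inj G e)) => S; apply: inCb_supported xk.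
Qed.

Lemma restrict_extend (y : cochain G') : restrict (extend y) = y.
Proof. exact/pushforwardK/del_state_inj. Qed.

Lemma extend_out (y : cochain G') (S : St G) : e \in S.1 -> extend y S = 0.
Proof.
move=> eS; apply: pushforward_out => T; apply/eqP => TS.
by move: eS; rewrite -TS (negbTE (notin_lift _ _)).
Qed.

(* Restriction is a cochain map: d_b on SG - e is d_b on SG read through the
   identification, as balanced cochains of SG are extensions by zero. *)
Lemma restrict_cochain_map : cochain_map restrict.
Proof.
split; first exact: pullbackB.
- by move=> k x xk T; rewrite ffunE => /xk /generator_del.
- move=> k x y xk db T; split => bT; rewrite ffunE.
    have bT' : balanced (del_state e T).1 by apply/balanced_del.
    by rewrite (proj1 (db _) bT') -{1}(extend_restrict xk) dd_pushforward.
  by rewrite (proj2 (db _)) // => /balanced_del.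
Qed.

(* Extension by zero is a cochain map: on states containing e both sides
   vanish, as such states are unbalanced. *)
Lemma extend_cochain_map : cochain_map extend.
Proof.
split; first exact: pushforwardB.
- move=> k y yk S; have [eS|/del_state_onto [T <-]] := boolP (e \in S.1).
    by rewrite extend_out ?eqxx.
  rewrite pushforwardE; last exact: del_state_inj.
  by move=> /yk /(generator_del k T).2.
- move=> k y y' _ db S; have [eS|/del_state_onto [T <-]] := boolP (e \in S.1).
    split=> [bS|_]; last exact: extend_out.
    by case: (neg_loop_unbalanced neg_loop_e eS bS).
  rewrite pushforwardE ?dd_pushforward; last exact: del_state_inj.
  by split=> bT; [apply: (proj1 (db T)); apply/balanced_del
                 | apply: (proj2 (db T)) => /balanced_del].
Qed.

End NegativeLoop.
Arguments restrict {G} e x.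
Arguments extend {G} e y.

Theorem proposition5p7 (G : SGraph) (e : 'I_(ne G)) :
  is_neg_loop e -> forall i : nat, Hb_iso G (del_edge e) i.
Proof.
move=> neg_loop_e i.
apply: (@Hb_iso_of_inverse_cochain_maps _ _ (restrict e) (extend e)).
- exact: restrict_cochain_map.
- exact: extend_cochain_map.
- by move=> k x; apply: extend_restrict.
- by move=> k y _; apply: restrict_extend.
Qed.
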